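(* Let $n\geq 2$ be an integer and let $f:\mathbb{Z}^n\rightarrow \mathbb{Z}^n$ be a map. The following properties are equivalent: (i) $f$ preserves all congruences of the additive group $(\mathbb{Z},+)^n$; (ii) $f$ preserves the congruences of $(\mathbb{Z},+)^n$ associated with the subgroups $\mathbb{Z}_{(k)}$ and $\mathbb{Z}_{(k,l)}$ for all $k,l<n$; (iii) there are $(a_i)_{i<n}\in \mathbb{Z}^n$ and $m\in \mathbb{Z}$ such that $f((x_i)_{i<n})=(a_i)_{i<n}+(m\cdot x_0,\dots,m\cdot x_{n-1})$ for all $(x_0,\dots,x_{n-1})\in \mathbb{Z}^n$.
   Context: Coordinates of elements of $\mathbb{Z}^n$ are indexed by $0,\dots,n-1$. For $k,l<n$, set $\mathbb{Z}_{(k)}:=\{(x_i)_{i<n}\in\mathbb{Z}^n: x_i=0 \text{ for all } i\neq k\}$ and $\mathbb{Z}_{(k,l)}:=\{(x_i)_{i<n}\in\mathbb{Z}^n: x_i=0\text{ for all } i\notin\{k,l\}\text{ and } x_k=-x_l\}$. The congruence associated with a subgroup $H$ of $\mathbb{Z}^n$ is the equivalence relation $x\equiv y$ iff $x-y\in H$; the congruences of the group are exactly these relations. A map $f$ preserves an equivalence relation $\rho$ if $(x,y)\in\rho$ implies $(f(x),f(y))\in\rho$. *)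

(* Defs.v *)
(* Elements of Z^n are row vectors of type 'rV[int]_n; subgroups and
   relations are Prop-valued so that no decidability is imposed on them. *)
From Stdlib Require Import RelationClasses.
From mathcomp Require Import all_boot all_order all_algebra.

Set Implicit Arguments.
Unset Strict Implicit.
Unset Printing Implicit Defensive.

Import GRing.Theory.
Local Open Scope ring_scope.

Definition preserves (T : Type) (f : T -> T) (rho : T -> T -> Prop) : Prop :=
  forall x y : T, rho x y -> rho (f x) (f y).

(* Compatibility with x |-> - x follows from compatibility with +. *)
Definition congruence_of_group (V : zmodType) (rho : V -> V -> Prop) : Prop :=
  Equivalence rho /\
  forall x x' y y' : V, rho x x' -> rho y y' -> rho (x + y) (x' + y').

Definition is_subgroup (V : zmodType) (H : V -> Prop) : Prop :=
  H 0 /\ forall x y : V, H x -> H y -> H (x - y).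

Definition congruence_mod (V : zmodType) (H : V -> Prop) (x y : V) : Prop :=
  H (x - y).

Lemma congruence_of_groupP (V : zmodType) (rho : V -> V -> Prop) :
  congruence_of_group rho <->
  exists2 H : V -> Prop,
    is_subgroup H & forall x y : V, rho x y <-> congruence_mod H x y.
Proof.
split=> [[[rr rs rt] rD] | [H [H0 HB] rhoE]].
- have rB x y : rho x y <-> rho (x - y) 0.
    split=> h; first by rewrite -(subrr y); apply: rD.
    by rewrite -[x](subrK y) -[X in rho _ X]add0r; apply: rD.
  exists (fun x => rho x 0); last exact: rB.
  split=> [|x y hx hy]; first exact: rr.
  by apply/rB; rewrite subr0; apply/(rB x y)/(rt _ 0) => //; apply: rs.
- have HN x : H x -> H (- x) by move=> hx; rewrite -sub0r; apply: HB.
  have HD x y : H x -> H y -> H (x + y).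
    by move=> hx hy; rewrite -[y]opprK; apply: HB => //; apply: HN.
  split; first split.
  + by move=> x; apply/rhoE; rewrite /congruence_mod subrr.
  + move=> x y /rhoE h; apply/rhoE.
    by rewrite /congruence_mod -opprB; apply: HN.
  + move=> x y z /rhoE hxy /rhoE hyz; apply/rhoE.
    by rewrite /congruence_mod -(subrKA y); apply: HD.
  + move=> x x' y y' /rhoE hx /rhoE hy; apply/rhoE.
    by rewrite /congruence_mod opprD addrACA; apply: HD.
Qed.

Definition Zcoord (n : nat) (k : 'I_n) (x : 'rV[int]_n) : Prop :=
  forall i : 'I_n, i != k -> x 0 i = 0.

(* k = l is allowed; x 0 k = - x 0 k then forces x = 0, so this is {0}. *)
Definition Zantidiag (n : nat) (k l : 'I_n) (x : 'rV[int]_n) : Prop :=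
  (forall i : 'I_n, i \notin [:: k; l] -> x 0 i = 0) /\ x 0 k = - x 0 l.

Lemma Zcoord_subgroup (n : nat) (k : 'I_n) : is_subgroup (Zcoord k).
Proof.
split=> [i _|x y hx hy i ik]; first by rewrite mxE.
by rewrite !mxE hx // hy // subrr.
Qed.

Lemma Zantidiag_subgroup (n : nat) (k l : 'I_n) : is_subgroup (Zantidiag k l).
Proof.
split=> [|x y [hx hxk] [hy hyk]]; split=> [i il|].
- by rewrite mxE.
- by rewrite !mxE oppr0.
- by rewrite !mxE hx // hy // subrr.
- by rewrite !mxE hxk hyk opprD.
Qed.

(* Main.v *)
(* Preserving the congruences of Z_(k) makes [f] act coordinatewise, as maps
   [F i : Z -> Z].  Preserving those of Z_(k,l) gives
   [F k (s + t) - F k s = F l u - F l (u - t)] for all [s], [t], [u] and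
   [k != l]; as [s] and [u] are independent, all unit increments of all the
   [F i] are one and the same integer [m]. *)
Require Import Defs.
From mathcomp Require Import all_boot all_order all_algebra.
From mathcomp Require Import lra.

Import GRing.Theory.
Local Open Scope ring_scope.

Lemma subgroup_mulrz {V : zmodType} {H : V -> Prop} (x : V) (m : int) :
  is_subgroup H -> H x -> H (x *~ m).
Proof.
move=> [H0 HB] Hx; have HN y : H y -> H (- y) by rewrite -sub0r; apply: HB.
elim/int_ind: m => [|m IHm|m IHm]; first by rewrite mulr0z.
- by rewrite intS addrC mulrzDr mulr1z -[X in _ + X]opprK; apply/HB/HN.
- by rewrite intS opprD addrC mulrzDr mulrN1z; apply: HB.
Qed.

Lemma affine_of_const_step (g : int -> int) (m : int) :
  (forall s, g (s + 1) - g s = m) -> forall s, g s = g 0 + m * s.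
Proof.
move=> g_step; elim/int_ind=> [|s IHs|s IHs]; first by rewrite mulr0 addr0.
- by rewrite intS addrC; have := g_step s; rewrite IHs; lra.
- by have := g_step (- s.+1%:Z); rewrite intS opprD addrAC addNr add0r IHs; lra.
Qed.

(** The entries of [x] other than the [i]-th are replaced by those of [y] one at a time. Each
    replacement, at some [k != i], moves the argument within a class modulo Z_(k), so the [i]-th
    coordinate of the value stays fixed. *)
Lemma coordinate_local {n : nat} {f : 'rV[int]_n -> 'rV[int]_n} :
    (forall k : 'I_n, preserves f (congruence_mod (Zcoord k))) ->
  forall (i : 'I_n) (x y : 'rV[int]_n), x 0 i = y 0 i -> f x 0 i = f y 0 i.
Proof.
move=> fZ i x y xyi.
pose mix (s : seq 'I_n) : 'rV[int]_n :=
  \row_j (if j \in s then y 0 j else x 0 j).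
have f_mix s : i \notin s -> f (mix s) 0 i = f x 0 i.
  elim: s => [_|k s IHs].
    by congr (f _ 0 i); apply/rowP=> j; rewrite mxE.
  rewrite inE negb_or => /andP[ik /IHs <-]; apply/eqP; rewrite -subr_eq0.
  have /fZ/(_ i ik) : congruence_mod (Zcoord k) (mix (k :: s)) (mix s).
    by move=> j /negPf jk; rewrite !mxE inE jk subrr.
  by rewrite !mxE => ->.
(* The list holds every index except [i]; since [x] and [y] agree at [i], mixing along it yields
   [y]. *)
rewrite -(f_mix (rem i (enum 'I_n))); last by rewrite mem_rem_uniqF ?enum_uniq.
congr (f _ 0 i); apply/rowP=> j.
rewrite mxE mem_rem_uniq ?enum_uniq// !inE mem_enum andbT.
by case: eqP => [->|].
Qed.

Lemma affine_of_preserves (n : nat) (f : 'rV[int]_n -> 'rV[int]_n) :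
    (2 <= n)%N ->
    (forall k : 'I_n, preserves f (congruence_mod (Zcoord k))) ->
    (forall k l : 'I_n, preserves f (congruence_mod (Zantidiag k l))) ->
  exists (a : 'rV[int]_n) (m : int), forall x, f x = a + m *: x.
Proof.
(* Any vector with [i]-th entry [t] would define the same [F i t]; the constant one serves all [i]
   at once. *)
case: n f => [|[|n]] // f _ fZ fA; pose F i t := f (const_mx t) 0 i.
have fE x i : f x 0 i = F i (x 0 i).
  by apply: coordinate_local fZ _ _ _ _; rewrite mxE.
have F_step k l s t u : k != l -> F k (s + t) - F k s = F l u - F l (u - t).
  move=> kl; have lk : (l == k) = false by rewrite eq_sym (negPf kl).
  (* With e_k, e_l the unit vectors, [x p q] is p e_k + q e_l, so [x (s + t) (u - t)] and [x s u]
     differ by t (e_k - e_l), an element of Z_(k,l). *)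
  pose x p q : 'rV[int]_n.+2 :=
    \row_j (if j == k then p else if j == l then q else 0).
  have /fA[_] : congruence_mod (Zantidiag k l) (x (s + t) (u - t)) (x s u).
    split=> [j|]; last first.
      by rewrite !mxE !eqxx lk addrAC subrr add0r addrAC subrr add0r opprK.
    rewrite !inE negb_or => /andP[/negPf jk /negPf jl].
    by rewrite !mxE jk jl subrr.
  by rewrite ![(f _ - f _) _ _]mxE ![(- f _) _ _]mxE !fE !mxE !eqxx lk opprB.
pose m := F ord0 1 - F ord0 0.
have F_unit k s : F k (s + 1) - F k s = m.
  have step0 j r : j != ord0 -> F j (r + 1) - F j r = m.
    by move=> /(F_step _ ord0 r 1 1) ->; rewrite subrr.
  (* Index [ord0] cannot be compared with itself, so its increments are matched with those of
     [ord_max], a different index because the dimension is at least 2. *)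
  have [->|/step0//] := eqVneq k ord0.
  by rewrite (F_step _ ord_max s 1 1) // subrr -(step0 ord_max 0) // add0r.
exists (\row_i F i 0), m => x; apply/rowP=> i.
by rewrite fE (affine_of_const_step _ _ (F_unit i)) !mxE.
Qed.

Theorem theorem8p1 (n : nat) (hn : (2 <= n)%N)
    (f : 'rV[int]_n -> 'rV[int]_n) :
  let i_ := forall rho : 'rV[int]_n -> 'rV[int]_n -> Prop,
    congruence_of_group rho -> preserves f rho in
  let ii_ := (forall k : 'I_n, preserves f (congruence_mod (Zcoord k))) /\
    (forall k l : 'I_n, preserves f (congruence_mod (Zantidiag k l))) in
  let iii_ := exists (a : 'rV[int]_n) (m : int),
    forall x : 'rV[int]_n, f x = a + m *: x in
  (i_ <-> ii_) /\ (ii_ <-> iii_).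
Proof.
move=> i_ ii_ iii_.
have i_ii : i_ -> ii_.
  move=> fi; split=> [k|k l]; apply: fi; apply/congruence_of_groupP.
  - by exists (Zcoord k) => //; apply: Zcoord_subgroup.
  - by exists (Zantidiag k l) => //; apply: Zantidiag_subgroup.
have ii_iii : ii_ -> iii_ by case; apply: affine_of_preserves.
have iii_i : iii_ -> i_.
  move=> [a [m fE]] rho /congruence_of_groupP[H sH rhoE] x y /rhoE Hxy.
  (* The translation [a] cancels: f x - f y = m (x - y), an integer multiple of an element of
     [H]. *)
  apply/rhoE; rewrite /congruence_mod !fE opprD addrACA subrr add0r -scalerBr.
  by rewrite -[m]intz scaler_int; apply: subgroup_mulrz.
by split; split; auto.
Qed.
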